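(* Let $\overline{M}$ be the persistence module indexed by $\mathbb{R}$ associated to a persistence module $M$ indexed by $[m]$ and an injective order-preserving map $\iota:[m+1]\to\mathbb{R}$. Let $k\ge1$, let $\lambda_k$ be the $k$-th persistence landscape of $\overline M$ and let $\operatorname{PD}_k=\sum_{i=1}^n c_i[a_i,b_i)$ be the $k$-th graded persistence diagram of $\overline M$, where $[a_i,b_i)\in\mathbb{R}^2_<$ are the points of its support and $c_i\in\{-1,1\}$. Let $m_i=\frac{a_i+b_i}{2}$ and $$\rho_k(t)=\sum_{i=1}^n c_i\left(\chi_{(a_i,m_i)}(t)-\chi_{(m_i,b_i)}(t)\right).$$ Then $\rho_k$ is the derivative of the $k$-th persistence landscape; that is, for all $t\in\mathbb{R}$, $\rho_k(t)=\lambda_k'(t)$ if $\lambda_k'(t)$ is defined, and $\rho_k(t)=0$ otherwise.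
   Context: Let $F$ be a field, $[m]=\{0<1<\dots<m\}$. A persistence module indexed by a sub-poset $P$ of $(\mathbb{R},\le)$ is a functor from $P$ to finite-dimensional $F$-vector spaces. Given $M$ indexed by $[m]$, extend it to $\hat M$ indexed by $[m+1]$ by $\hat M(m+1)=0$. Given an injective order-preserving $\iota:[m+1]\to\mathbb{R}$, $\overline M$ is the persistence module indexed by $\mathbb{R}$ with $\overline M(a)=\hat M(i)$, where $i$ is the largest element of $[m+1]$ with $\iota(i)\le a$, and $\overline M(a)=0$ if $a<\iota(0)$, with structure maps induced by those of $\hat M$. For a poset $P$, $P^2_<$ denotes the poset of half-open intervals $[a,b)$, $a<b$ in $P$, ordered by inclusion. $\operatorname{Rank}(M)[a,b)=\operatorname{rank}M(a\le b-1)$ for $[a,b)\in[m+1]^2_<$, and $\operatorname{Rank}(\overline M)[a,b)=\min_{a\le c<b}\operatorname{rank}\overline M(a\le c)$ for $[a,b)\in\mathbb{R}^2_<$. For $k\ge1$, $\operatorname{Rank}_k=u_k\circ\operatorname{Rank}$, where $u_k(n)=1$ if $n\ge k$ and $0$ otherwise. The $k$-th graded persistence diagram of $M$ is $\operatorname{PD}_k(M):[m+1]^2_<\to\mathbb{Z}$, $\operatorname{PD}_k(M)(I)=\sum_{I\subseteq I'}\mu[I,I']\operatorname{Rank}_k(M)(I')$, where $\mu$ is the Möbius function of $[m+1]^2_<$ ($\mu[x,x]=1$, $\mu[x,y]=-\sum_{x\le y'<y}\mu[x,y']$ for $x<y$). It takes values in $\{-1,0,1\}$. The $k$-th graded persistence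 diagram of $\overline M$ is $\operatorname{PD}_k(\overline M):\mathbb{R}^2_<\to\mathbb{Z}$ with $\operatorname{PD}_k(\overline M)[\iota(x),\iota(y))=\operatorname{PD}_k(M)[x,y)$ and value $0$ on all other intervals. In the sum $\sum_i c_i[a_i,b_i)$, the symbol $[a_i,b_i)$ denotes the indicator function on $\mathbb{R}^2_<$ of that element. The $k$-th persistence landscape is $\lambda_k(t)=\sup\{h>0 : \operatorname{Rank}_k(\overline M)[t-h,t+h)=1\}$, with $\lambda_k(t)=0$ if this set is empty. $\chi_{(a,b)}:\mathbb{R}\to\mathbb{R}$ is the indicator function of the open interval $(a,b)$. *)

(* Defs.v *)
(* MathComp / MathComp-Analysis; the real line is an arbitrary [R : realType]. *)
From HB Require Import structures.
From mathcomp Require Import all_boot all_order all_algebra.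
From mathcomp Require Import all_classical all_reals all_analysis.

Set Implicit Arguments.
Unset Strict Implicit.
Unset Printing Implicit Defensive.

Import Order.TTheory GRing.Theory Num.Theory.
Import numFieldNormedType.Exports.

Local Open Scope classical_set_scope.
Local Open Scope ring_scope.

(** * Persistence modules *)

(* Functors from the poset [P] (seen as a category) to finite-dimensional
   [F]-vector spaces. *)
Record persmod (F : fieldType) d (P : porderType d) := PersMod {
  pobj :> P -> vectType F;
  pmap : forall x y : P, (x <= y)%O -> 'Hom(pobj x, pobj y);
  pmap_id : forall (x : P) (h : (x <= x)%O), pmap h = \1%VF;
  pmap_comp : forall (x y z : P)
      (hxy : (x <= y)%O) (hyz : (y <= z)%O) (hxz : (x <= z)%O),
    pmap hxz = (pmap hyz \o pmap hxy)%VF }.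

Definition prank F d (P : porderType d) (M : persmod F P) (x y : P)
  (h : (x <= y)%O) : nat := \dim (limg (pmap M h)).

(* Both [hat M] and [bar M] arise by reindexing along a partial monotone map
   [f : Q -> option P]: the value at [q] is [M p] when [f q = Some p] and the
   zero space when [f q = None], and the structure maps are those of [M] where both
   indices are defined and [0] otherwise. This is functorial as soon as the domain of
   [f] is order-convex. *)
Definition ole d (P : porderType d) (o o' : option P) : bool :=
  match o, o' with Some i, Some j => (i <= j)%O | _, _ => true end.

Definition oobj F d (P : porderType d) (M : persmod F P) (o : option P) :
  vectType F := if o is Some i then M i else 'rV[F]_0.

Definition oapp_map F d (P : porderType d) (M : persmod F P) (o o' : option P) :
    ole o o' -> 'Hom(oobj M o, oobj M o') :=
  match o, o' return ole o o' -> 'Hom(oobj M o, oobj M o') with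
  | Some i, Some j => fun h => pmap M h
  | _, _ => fun _ => 0
  end.

Section Reindex.
Variables (F : fieldType) (d d' : Order.disp_t).
Variables (P : porderType d) (Q : porderType d') (M : persmod F P).
Variables (f : Q -> option P).
Hypothesis f_mono : forall x y : Q, (x <= y)%O -> ole (f x) (f y).
Hypothesis f_convex : forall x y z : Q,
  (x <= y)%O -> (y <= z)%O -> f x -> f z -> f y.

Fact reindex_id (x : Q) (h : (x <= x)%O) : oapp_map M (f_mono h) = \1%VF.
Proof.
move: (f_mono h); case: (f x) => [i|] /= h'; first exact: pmap_id.
by apply/lfunP => v; rewrite [LHS](@thinmx0 _ 1) [RHS](@thinmx0 _ 1).
Qed.

Fact reindex_comp (x y z : Q)
    (hxy : (x <= y)%O) (hyz : (y <= z)%O) (hxz : (x <= z)%O) :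
  oapp_map M (f_mono hxz) = (oapp_map M (f_mono hyz) \o oapp_map M (f_mono hxy))%VF.
Proof.
move: (f_mono hxz) (f_mono hyz) (f_mono hxy) (f_convex hxy hyz).
case: (f x) => [i|]; case: (f y) => [j|]; case: (f z) => [k|] /= h1 h2 h3 cv;
  rewrite ?comp_lfun0l ?comp_lfun0r //.
- exact: pmap_comp.
- by have := cv isT isT.
Qed.

Definition reindex : persmod F Q :=
  @PersMod F d' Q (fun x => oobj M (f x))
    (fun x y h => oapp_map M (f_mono h)) reindex_id reindex_comp.

End Reindex.

(* [m] is 'I_m.+1 and [m+1] is 'I_m.+2, whose largest element is [ord_max]. *)
Fact hat_mono m (x y : 'I_m.+2) :
  (x <= y)%O -> ole (unlift ord_max x) (unlift ord_max y).
Proof.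
case: (unliftP ord_max x) => [i ->|->]; case: (unliftP ord_max y) => [j ->|->] //.
by rewrite /= !leEord /= leq_bump2.
Qed.

Fact hat_convex m (x y z : 'I_m.+2) : (x <= y)%O -> (y <= z)%O ->
  unlift ord_max x -> unlift ord_max z -> unlift ord_max y.
Proof.
move=> _; case: (unliftP ord_max y) => [j ->|->] //.
case: (unliftP ord_max z) => [k ->|->] //.
move=> h; have {h} : (m.+1 <= lift ord_max k)%N := h.
by rewrite lift_max leqNgt ltn_ord.
Qed.

Definition hatM F m (M : persmod F 'I_m.+1) : persmod F 'I_m.+2 :=
  reindex M (@hat_mono m) (@hat_convex m).

(* The largest [i] with [iota i <= a], or [None] if [a < iota 0]. *)
Definition bar_idx (R : realType) m (iota : 'I_m.+2 -> R) (a : R) :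
    option 'I_m.+2 :=
  if a < iota ord0 then None else
  Some [arg max_(i > ord0 | iota i <= a) i]%O.

Fact bar_mono (R : realType) m (iota : 'I_m.+2 -> R) (a b : R) :
  (a <= b)%O -> ole (bar_idx iota a) (bar_idx iota b).
Proof.
move=> ab; rewrite /bar_idx; case: ltP => // ia; case: ltP => // ib /=.
case: arg_maxP => // i Hi _; case: arg_maxP => // j _; apply.
exact: le_trans ab.
Qed.

Fact bar_convex (R : realType) m (iota : 'I_m.+2 -> R) (a b c : R) :
  (a <= b)%O -> (b <= c)%O -> bar_idx iota a -> bar_idx iota c -> bar_idx iota b.
Proof.
move=> ab _; rewrite /bar_idx; case: (ltP a) => // ia _ _.
by rewrite ltNge (le_trans ia ab).
Qed.

Definition barM (R : realType) F m (iota : 'I_m.+2 -> R)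
    (M : persmod F 'I_m.+1) : persmod F R :=
  reindex (hatM M) (@bar_mono R m iota) (@bar_convex R m iota).

(** * Half-open intervals *)

(* [hoitv P] is the poset of intervals [a, b), a < b in P. *)
Record hoitv d (P : porderType d) := HoItv {
  ho_ends : P * P;
  ho_lt : (ho_ends.1 < ho_ends.2)%O }.

HB.instance Definition _ d (P : porderType d) := [isSub for @ho_ends d P].
HB.instance Definition _ d (P : porderType d) := [Choice of hoitv P by <:].

Definition lo d (P : porderType d) (I : hoitv P) : P := (ho_ends I).1.
Definition hi d (P : porderType d) (I : hoitv P) : P := (ho_ends I).2.

(* The order is the inclusion order of MathComp's type [interval P]. *)
Definition ho_le d (P : porderType d) : rel (hoitv P) :=
  fun I J => (`[lo I, hi I[ <= `[lo J, hi J[)%O.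

Lemma ho_leE d (P : porderType d) (I J : hoitv P) :
  ho_le I J = (lo J <= lo I)%O && (hi I <= hi J)%O.
Proof. by []. Qed.

Fact ho_le_refl d (P : porderType d) : reflexive (@ho_le d P).
Proof. by move=> I; exact: lexx. Qed.

Fact ho_le_anti d (P : porderType d) : antisymmetric (@ho_le d P).
Proof.
move=> I J; rewrite !ho_leE => /andP[/andP[a b] /andP[c e]]; apply: val_inj.
rewrite /= [LHS]surjective_pairing [RHS]surjective_pairing.
by congr (_, _); apply/le_anti/andP.
Qed.

Fact ho_le_trans d (P : porderType d) : transitive (@ho_le d P).
Proof. by move=> J I K; exact: le_trans. Qed.

HB.instance Definition _ d (P : porderType d) :=
  Order.Le_isPOrder.Build d (hoitv P)
    (@ho_le_refl d P) (@ho_le_anti d P) (@ho_le_trans d P).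
HB.instance Definition _ d (P : finPOrderType d) :=
  [Countable of hoitv P by <:].
HB.instance Definition _ d (P : finPOrderType d) := [Finite of hoitv P by <:].

(* On a total order, [<=] on [hoitv P] is inclusion of the underlying sets. *)
Lemma ho_leP d (P : orderType d) (I J : hoitv P) :
  reflect (forall c : P, (lo I <= c < hi I)%O -> (lo J <= c < hi J)%O)
          (I <= J)%O.
Proof.
apply: (iffP idP) => [|H].
  rewrite [(_ <= _)%O]ho_leE => /andP[h1 h2] c /andP[h3 h4].
  by rewrite (le_trans h1 h3) (lt_le_trans h4 h2).
have /andP[h1 h2] : (lo J <= lo I < hi J)%O by apply: H; rewrite lexx (ho_lt I).
rewrite [(_ <= _)%O]ho_leE h1 leNgt; apply/negP => h3.
by have := H (hi J); rewrite (ltW h2) h3 ltxx andbF => /(_ isT).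
Qed.

(** * The Möbius function of a finite poset *)

Fixpoint mobius_rec d (T : finPOrderType d) (n : nat) (x y : T) : int :=
  if x == y then 1 else
  if n is n'.+1 then
    if (x < y)%O then - \sum_(z : T | (x <= z < y)%O) mobius_rec n' x z else 0
  else 0.

(* The fuel [#|T|] suffices: see [mobius_lt]. *)
Definition mobius d (T : finPOrderType d) (x y : T) : int :=
  mobius_rec #|T| x y.

Lemma mobius_refl d (T : finPOrderType d) (x : T) : mobius x x = 1.
Proof. by rewrite /mobius; case: #|T| => [|n] /=; rewrite eqxx. Qed.

Lemma mobius_recE d (T : finPOrderType d) (x y : T) (n n' : nat) :
  (#|[pred z : T | (z < y)%O]| <= n)%N -> (#|[pred z : T | (z < y)%O]| <= n')%N ->
  mobius_rec n x y = mobius_rec n' x y.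
Proof.
elim: n n' y => [|n IH] n' y.
  rewrite leqn0 => /eqP/card0_eq y0 _.
  have /negbTE xy : ~~ (x < y)%O.
    by apply/negP => xy; have := y0 x; rewrite !inE xy.
  by case: n' => [|n'] /=; rewrite ?xy.
case: n' => [_|n'].
  rewrite leqn0 => /eqP/card0_eq y0.
  have /negbTE xy : ~~ (x < y)%O.
    by apply/negP => xy; have := y0 x; rewrite !inE xy.
  by rewrite /= ?xy.
move=> h h' /=; case: eqP => // _; case: ifP => // _; congr (- _).
apply: eq_bigr => z /andP[_ zy].
have pr : [pred w : T | (w < z)%O] \proper [pred w : T | (w < y)%O].
  apply/fintype.properP; split; last by exists z; rewrite !inE ?ltxx.
  by apply/fintype.subsetP => w; rewrite !inE => /lt_trans; apply.
by apply: IH; rewrite -ltnS (leq_trans (proper_card pr)).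
Qed.

Lemma mobius_lt d (T : finPOrderType d) (x y : T) : (x < y)%O ->
  mobius x y = - \sum_(z : T | (x <= z < y)%O) mobius x z.
Proof.
move=> xy; rewrite {1}/mobius.
rewrite (@mobius_recE _ _ x y _ #|T|.+1) ?max_card //; last first.
  by rewrite (leq_trans (max_card _)).
by rewrite /= (lt_eqF xy) xy.
Qed.

(** * Rank functions and graded persistence diagrams *)

(* [a, b) in [m+1]^2_< has a <= b - 1 <= m, so that both ends below are the
   indicated elements of [m]. *)
Fact Rank_fin_le m (I : hoitv 'I_m.+2) :
  ((inord (lo I) : 'I_m.+1) <= inord (hi I).-1)%O.
Proof.
have h : (lo I < hi I)%N := ho_lt I.
have h' : ((hi I).-1 < m.+1)%N by have := ltn_ord (hi I); case: (val (hi I)).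
have h'' : (lo I <= (hi I).-1)%N by move: h; case: (val (hi I)).
by rewrite leEord /= !inordK // (leq_ltn_trans h'').
Qed.

Definition Rank_fin F m (M : persmod F 'I_m.+1) (I : hoitv 'I_m.+2) : nat :=
  prank M (Rank_fin_le I).

(* The set of values rank M(a <= c), a <= c < b. *)
Definition ranks_on (R : realType) F (M : persmod F R) (I : hoitv R) :
    pred nat :=
  fun n => `[< exists (c : R) (h : (lo I <= c)%O),
                 c < hi I /\ prank M h = n >].

Fact ranks_on_ex (R : realType) F (M : persmod F R) (I : hoitv R) :
  exists n, ranks_on M I n.
Proof.
exists (prank M (lexx (lo I))); apply/asboolP.
by exists (lo I), (lexx (lo I)); split => //; exact: ho_lt.
Qed.

Definition Rank_real (R : realType) F (M : persmod F R) (I : hoitv R) : nat :=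
  ex_minn (ranks_on_ex M I).

Definition ucut (k n : nat) : nat := if (k <= n)%N then 1%N else 0%N.

Definition Rank_fin_k F m (M : persmod F 'I_m.+1) (k : nat) :
  hoitv 'I_m.+2 -> nat := ucut k \o Rank_fin M.

Definition Rank_real_k (R : realType) F (M : persmod F R) (k : nat) :
  hoitv R -> nat := ucut k \o Rank_real M.

Definition PD_fin F m (M : persmod F 'I_m.+1) (k : nat) (I : hoitv 'I_m.+2) :
    int :=
  \sum_(I' : hoitv 'I_m.+2 | (I <= I')%O)
    mobius I I' * (Rank_fin_k M k I')%:Z.

(* The value at [iota x, iota y) is that of [PD_fin] at [x, y); such [x, y) is
   unique for injective [iota]. *)
Definition PD_bar (R : realType) F m (iota : 'I_m.+2 -> R)
    (M : persmod F 'I_m.+1) (k : nat) (J : hoitv R) : int :=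
  if [pick K : hoitv 'I_m.+2 | (iota (lo K) == lo J) && (iota (hi K) == hi J)]
    is Some K then PD_fin M k K else 0.

(** * Persistence landscapes *)

Fact centered_lt (R : realType) (t h : R) : 0 < h -> (t - h < t + h)%O.
Proof. by move=> h0; rewrite ltrD2l gtrN. Qed.

Definition centered (R : realType) (t h : R) (h0 : 0 < h) : hoitv R :=
  @HoItv _ R (t - h, t + h) (centered_lt t h0).

(* [sup] of the empty set is [0] in MathComp-Analysis ([sup0]). *)
Definition landscape (R : realType) F (M : persmod F R) (k : nat) (t : R) : R :=
  sup [set h : R | exists h0 : 0 < h, Rank_real_k M k (centered t h0) = 1%N].

Definition midpoint (R : realType) (J : hoitv R) : R := (lo J + hi J) / 2.

Definition rho (R : realType) n (J : 'I_n -> hoitv R) (c : 'I_n -> int)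
    (t : R) : R :=
  \sum_(i < n) (c i)%:~R *
    (\1_(`]lo (J i), midpoint (J i)[%classic) t
     - \1_(`]midpoint (J i), hi (J i)[%classic) t).

(* Main.v *)
Require Import Defs.
From mathcomp Require Import all_boot all_order all_algebra.
From mathcomp Require Import all_classical all_reals all_analysis.
From mathcomp Require Import ring lra zify.

Import Order.TTheory GRing.Theory Num.Theory.
Import numFieldNormedType.Exports.

Local Open Scope classical_set_scope.
Local Open Scope ring_scope.

(** Let [E] be the set of intervals [x, y) of [m+1] on which [M] has rank at least
[k]. Rank decreases under inclusion of intervals, so [E] is closed under
sub-intervals, and an interval of the real line has rank at least [k] exactly when
it lies in [iota x, iota y) for some [x, y) in [E] ([Rank_real_barP]). Hence the
landscape is a finite maximum of tents,
  lambda t = max (0, max_(K in E) min (t - a_K, b_K - t)),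
with a_K, b_K the images of the end points of K ([landscape_tent_max]).

Near a point t with l = lambda t > 0 this maximum is governed by two yes-or-no
questions about the maximal centered interval [t - l, t + l): can it be prolonged a
little to the right inside a member of [E], and can it be prolonged a little to the
left? If only to the right, the left end is blocked and lambda has slope 1; if only
to the left, slope -1; if both, t is a local minimum, and if neither, a local
maximum ([tent_max_up], [tent_max_down], [tent_max_valley], [tent_max_peak]). At a
local extremum the derivative is 0 whenever it exists, and so it is when l = 0,
because lambda >= 0. So it is enough to show that rho t is
  [l > 0 and prolongable to the right] - [l > 0 and prolongable to the left].

For this, rho t = S+ - S-, where S+ sums PD over the intervals K with a_K < t < m_K
and S- over those with m_K < t < b_K. Split S+ according to the left end v of the
interval. By Moebius inversion the sum of PD over all intervals containing a given
one is the indicator of [E] ([mobius_inversion], [cut_sum]). So the part of S+ with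
left end v is the difference of two indicators, those of <<some K in E has a_K <= v
and b_K > 2t - v>> and of <<some K in E has a_K < v and b_K > 2t - v>>. The second
says lambda t > t - v; the first without the second says that v = t - l and that
the maximal centered interval can be prolonged to the right ([cut_at_left_end]).
Thus only v = t - l contributes, which evaluates S+ ([rising_sum]); reflecting the
line in the origin exchanges S+ and S-, left and right. *)

Set Implicit Arguments.
Unset Strict Implicit.
Unset Printing Implicit Defensive.

(** * Moebius inversion for intervals *)

Lemma mobius_nle d (T : finPOrderType d) (x y : T) :
  ~~ (x <= y)%O -> mobius x y = 0.
Proof.
move=> xy; rewrite /mobius; case: #|T| => [|n] /=.
  by case: eqP xy => // ->; rewrite lexx.
case: eqP xy => [->|_ xy]; first by rewrite lexx.
by case: ifP => // /ltW; rewrite (negbTE xy).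
Qed.

Lemma sum_mobius d (T : finPOrderType d) (x y : T) :
  \sum_(z : T | (z <= y)%O) mobius x z = (x == y)%:Z.
Proof.
rewrite (bigID (fun z => (x <= z)%O)) /= [X in _ + X]big1 ?addr0; last first.
  by move=> z /andP[_]; exact: mobius_nle.
have [<-|xy] := eqVneq x y.
  rewrite (big_pred1 x) ?mobius_refl // => z /=; rewrite -eq_le.
  by apply/eqP/eqP => ->.
have [lxy|nxy] := boolP (x < y)%O; last first.
  rewrite big1 // => z /andP[zy xz]; move: nxy.
  by rewrite lt_neqAle xy (le_trans xz zy).
rewrite (bigD1 y) /= ?lexx ?ltW // mobius_lt // addrC; apply/eqP.
rewrite subr_eq0; apply/eqP/eq_bigl => z.
by rewrite lt_neqAle; case: (_ <= _)%O; rewrite ?andbF //= andbT andbC.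
Qed.

(** The recursion makes the Moebius function a left inverse of the zeta function in
the algebra of square matrices indexed by the poset, where a left inverse is also a
right inverse. *)
Lemma sum_mobius_dual d (T : finPOrderType d) (x y : T) :
  \sum_(z : T | (x <= z)%O) mobius z y = (x == y)%:Z.
Proof.
pose zeta := \matrix_(i < #|T|, j < #|T|) (enum_val i <= enum_val j)%O%:Z.
pose mu := \matrix_(i < #|T|, j < #|T|) mobius (enum_val i) (enum_val j).
have mz : mu *m zeta = 1%:M.
  apply/matrixP => i j; rewrite !mxE.
  rewrite -(inj_eq enum_val_inj) natz -sum_mobius.
  rewrite [RHS]big_mkcond (reindex _ (onW_bij _ (@enum_val_bij T))) /=.
  by apply: eq_bigr => l _; rewrite !mxE; case: ifP; rewrite ?mulr1 ?mulr0.
have := mulmx1C mz => /matrixP/(_ (enum_rank x) (enum_rank y)).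
rewrite !mxE (inj_eq enum_rank_inj) natz => <-.
rewrite big_mkcond (reindex _ (onW_bij _ (@enum_val_bij T))) /=.
by apply: eq_bigr => l _; rewrite !mxE !enum_rankK; case: ifP; rewrite ?mul1r ?mul0r.
Qed.

Lemma mobius_inversion d (T : finPOrderType d) (f : T -> int) (x : T) :
  \sum_(y : T | (x <= y)%O) \sum_(z : T | (y <= z)%O) mobius y z * f z = f x.
Proof.
under eq_bigr => y _.
  rewrite big_mkcond (eq_bigr (fun z => mobius y z * f z)); last first.
    by move=> z _; case: ifPn => // /mobius_nle ->; rewrite mul0r.
  over.
rewrite exchange_big /=.
under eq_bigr do rewrite -mulr_suml sum_mobius_dual.
rewrite (bigD1 x) //= eqxx mul1r big1 ?addr0 // => z.
by rewrite eq_sym => /negbTE ->; rewrite mul0r.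
Qed.

(** If [P] and [Q] are both inhabited, the intervals summed over are exactly those
that contain [max P, min Q), and Moebius inversion applies; otherwise there are
none. *)
Lemma cut_sum d (T : finOrderType d) (e : pred (hoitv T)) (P Q : pred T) :
    (forall K K' : hoitv T, (K <= K')%O -> e K' -> e K) ->
    (forall x y : T, (x <= y)%O -> P y -> P x) ->
    (forall x y : T, (x <= y)%O -> Q x -> Q y) ->
    (forall x y : T, P x -> Q y -> (x < y)%O) ->
  \sum_(K : hoitv T | P (lo K) && Q (hi K))
     \sum_(K' : hoitv T | (K <= K')%O) mobius K K' * (e K')%:Z
  = [exists K, [&& e K, P (lo K) & Q (hi K)]]%:Z.
Proof.
move=> e_down Pdown Qup PQ.
have [x0 Px0|P0] := pickP P; last first.
  rewrite big_pred0 => [|K]; last by rewrite P0.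
  by case: existsP => // -[K]; rewrite P0 andbF.
have [y0 Qy0|Q0] := pickP Q; last first.
  rewrite big_pred0 => [|K]; last by rewrite Q0 andbF.
  by case: existsP => // -[K]; rewrite Q0 !andbF.
case: (@arg_maxP _ _ _ x0 P id Px0) => x Px xmax.
case: (@arg_minP _ _ _ y0 Q id Qy0) => y Qy ymin.
pose K0 := @HoItv _ T (x, y) (PQ _ _ Px Qy).
have filterE K : P (lo K) && Q (hi K) = (K0 <= K)%O.
  rewrite [RHS]ho_leE; apply/andP/andP => -[].
    by move=> /xmax ? /ymin.
  by move=> /Pdown-/(_ Px) ? /Qup-/(_ Qy).
under eq_bigl do rewrite filterE.
rewrite mobius_inversion; congr (nat_of_bool _)%:Z; apply/idP/existsP.
  by move=> eK0; exists K0; rewrite eK0 filterE lexx.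
by move=> [K]; rewrite filterE => /andP[eK /e_down]; apply.
Qed.

(** * Derivatives at local extrema *)

(** Fermat's theorem for a function that is differentiable at the extremum only: a
nonzero limit of the difference quotients would give them a constant sign on both
sides of [t]. *)
Lemma local_max_derive (R : realType) (f : R -> R) (t : R) :
  derivable f t 1 -> (\forall s \near t, f s <= f t) -> (f^`())%classic t = 0.
Proof.
rewrite derive1E => fd /nbhs_ballP[r /= r0 tmax].
have quotient (P : R -> bool) : (\forall x \near 'D_1 f t, P x) ->
    exists2 d : R, 0 < d & forall h, h != 0 -> `|h| < d ->
      f (h + t) <= f t /\ P (h^-1 * (f (h + t) - f t)).
  move=> /fd[d /= d0 dP]; exists (Num.min d r).
    by rewrite lt_min d0.
  move=> h h0; rewrite lt_min => /andP[hd hr]; split.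
    by apply: tmax; rewrite /ball /= opprD addrCA subrr addr0 normrN.
  have := dP h; rewrite /= sub0r normrN => /(_ hd h0).
  by rewrite /= [h *: _]mulr1.
apply/eqP; rewrite eq_le !leNgt; apply/andP; split; apply/negP.
  move=> /lt_nbhsr/quotient[d d0 dP].
  have h0 : 0 < d / 2 by lra.
  have [] := dP _ (lt0r_neq0 h0); first by rewrite gtr0_norm //; lra.
  rewrite -subr_le0 => fh; apply/negP; rewrite -leNgt.
  by rewrite mulr_ge0_le0 // invr_ge0 ltW.
move=> /lt_nbhsl/quotient[d d0 dP].
have h0 : - (d / 2) < 0 by lra.
have [] := dP _ (ltr0_neq0 h0); first by rewrite ltr0_norm //; lra.
rewrite -subr_le0 => fh; apply/negP; rewrite -leNgt.
by rewrite mulr_le0 // invr_le0 ltW.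
Qed.

Lemma local_min_derive (R : realType) (f : R -> R) (t : R) :
  derivable f t 1 -> (\forall s \near t, f t <= f s) -> (f^`())%classic t = 0.
Proof.
move=> fd fmin; apply/eqP; rewrite -oppr_eq0 derive1E -deriveN // -derive1E.
apply/eqP/local_max_derive; first exact: derivableN.
by apply: filterS fmin => s; rewrite lerN2.
Qed.

(** * Maxima of tents *)

Definition tent_max (R : realType) (T : finType) (e : pred T) (a b : T -> R)
    (t : R) : R :=
  \big[Num.max/0]_(K | e K) Num.min (t - a K) (b K - t).

Lemma tent_max_ge0 (R : realType) (T : finType) (e : pred T) (a b : T -> R) t :
  0 <= tent_max e a b t.
Proof. by apply/bigmax_geP; left. Qed.

Lemma tent_max_leP (R : realType) (T : finType) (e : pred T) (a b : T -> R) t h :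
  reflect (0 <= h /\ forall K, e K -> t - a K <= h \/ b K - t <= h)
          (tent_max e a b t <= h).
Proof.
apply: (iffP (bigmax_leP _ _ _ _)) => -[h0 H]; split=> // K /H;
  by rewrite ge_min => /orP.
Qed.

Lemma tent_max_geP (R : realType) (T : finType) (e : pred T) (a b : T -> R) t h :
  0 < h ->
  reflect (exists2 K, e K & a K <= t - h /\ t + h <= b K) (h <= tent_max e a b t).
Proof.
move=> h0; apply: (iffP (bigmax_geP _ _ _ _)) => [[|[K eK]]|[K eK [aK bK]]].
- by rewrite leNgt h0.
- by rewrite le_min => /andP[? ?]; exists K => //; split; lra.
- by right; exists K => //; rewrite le_min; apply/andP; split; lra.
Qed.

(** The reflection of the line in the origin, which exchanges the roles of left and
right ends. *)
Lemma tent_max_opp (R : realType) (T : finType) (e : pred T) (a b : T -> R) t :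
  tent_max e (fun K => - b K) (fun K => - a K) (- t) = tent_max e a b t.
Proof.
by apply: eq_bigr => K _; rewrite minC; congr (Num.min _ _); ring.
Qed.

(** Whether the maximal centered interval around [t] can be enlarged on the right
only and still lie in a member of [e]. *)
Definition extends_right (R : realType) (T : finType) (e : pred T) (a b : T -> R)
    (t : R) : bool :=
  [exists K, [&& e K, a K <= t - tent_max e a b t & t + tent_max e a b t < b K]].

(** The mirror image of [extends_right]; unfolded in [extends_leftE]. *)
Definition extends_left (R : realType) (T : finType) (e : pred T) (a b : T -> R)
    (t : R) : bool :=
  extends_right e (fun K => - b K) (fun K => - a K) (- t).

Lemma extends_leftE (R : realType) (T : finType) (e : pred T) (a b : T -> R) t :
  extends_left e a b t =
  [exists K, [&& e K, a K < t - tent_max e a b t & t + tent_max e a b t <= b K]].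
Proof.
rewrite /extends_left /extends_right tent_max_opp.
apply: eq_existsb => K; congr (_ && _); rewrite andbC.
by congr (_ && _); apply/idP/idP; lra.
Qed.

(** Let [l] be the value at [t]. A member of [e] that starts to the left of [t - l] ends before [t + l], so close
to [t] its tent lies below the tent of the member that prolongs the maximal interval
to the right, and that member starts exactly at [t - l]. *)
Lemma tent_max_up (R : realType) (T : finType) (e : pred T) (a b : T -> R) t :
  0 < tent_max e a b t -> extends_right e a b t -> ~~ extends_left e a b t ->
  \forall s \near t, tent_max e a b s = s - (t - tent_max e a b t).
Proof.
rewrite extends_leftE /extends_right => l0.
set l := tent_max e a b t in l0 *.
move=> /existsP[K0 /and3P[eK0 aK0 bK0]] /existsPn noleft.
have Kshort : \forall s \near t, forall K, b K < t + l -> b K - s <= s - (t - l).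
  apply: (filter_forall (nbhs_filter t)) => K;
  case: (ltP (b K) (t + l)) => [bK|_]; last exact: nearW.
  have /lt_nbhsr : (b K + t - l) / 2 < t by lra.
  by apply: filterS => s; lra.
have /lt_nbhsl K0long : t < (b K0 + t - l) / 2 by lra.
have /lt_nbhsr pos : t - l < t by lra.
apply: filterS3 Kshort K0long pos => s Kshort K0long pos.
apply/eqP; rewrite eq_le; apply/andP; split.
  apply/tent_max_leP; split=> [|K eK]; first by lra.
  have := noleft K; rewrite eK /= negb_and -ltNge -leNgt => /orP[?|/Kshort ?].
    by left; lra.
  by right.
have pos' : 0 < s - (t - l) by lra.
apply/(tent_max_geP _ _ _ _ pos').
by exists K0 => //; split; lra.
Qed.

Lemma extends_left_opp (R : realType) (T : finType) (e : pred T) (a b : T -> R) t :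
  extends_left e (fun K => - b K) (fun K => - a K) (- t) = extends_right e a b t.
Proof.
rewrite /extends_left opprK; congr (extends_right _ _ _ _);
  by apply/funext => K; rewrite opprK.
Qed.

Lemma tent_max_down (R : realType) (T : finType) (e : pred T) (a b : T -> R) t :
  0 < tent_max e a b t -> ~~ extends_right e a b t -> extends_left e a b t ->
  \forall s \near t, tent_max e a b s = (t + tent_max e a b t) - s.
Proof.
rewrite -tent_max_opp -extends_left_opp => l0 nright left.
have near_opp (P : set R) : (\forall s \near - t, P s) -> \forall s \near t, P (- s).
  exact: (@opp_continuous R^o t).
have := near_opp _ (tent_max_up l0 left nright).
by apply: filterS => s; rewrite !tent_max_opp => ->; ring.
Qed.

(** Prolonging to the right leaves room for the same half-width around points slightly
to the right of [t], and likewise on the left. *)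
Lemma tent_max_valley (R : realType) (T : finType) (e : pred T) (a b : T -> R) t :
  extends_right e a b t -> extends_left e a b t ->
  \forall s \near t, tent_max e a b t <= tent_max e a b s.
Proof.
rewrite extends_leftE /extends_right; set l := tent_max e a b t.
move=> /existsP[K1 /and3P[eK1 aK1 bK1]] /existsP[K2 /and3P[eK2 aK2 bK2]].
have /lt_nbhsl K1long : t < b K1 - l by lra.
have /lt_nbhsr K2long : a K2 + l < t by lra.
apply: filterS2 K1long K2long => s K1long K2long.
have : 0 <= l by exact: tent_max_ge0.
rewrite le_eqVlt => /predU1P[<-|l0]; first exact: tent_max_ge0.
apply/(tent_max_geP _ _ _ _ l0); case: (leP t s) => ts.
  by exists K1 => //; split; lra.
by exists K2 => //; split; lra.
Qed.

(** Let [l] be the value at [t]. If one of [t - a K] and [b K - t] is less than [l],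
it remains so for nearby centers; otherwise, nothing being prolongable, the member
is [t - l, t + l) itself, whose tent peaks at [t]. *)
Lemma tent_max_peak (R : realType) (T : finType) (e : pred T) (a b : T -> R) t :
  ~~ extends_right e a b t -> ~~ extends_left e a b t ->
  \forall s \near t, tent_max e a b s <= tent_max e a b t.
Proof.
rewrite extends_leftE /extends_right; set l := tent_max e a b t.
move=> /existsPn noright /existsPn noleft.
have a_near : \forall s \near t, forall K, t - l < a K -> s - a K <= l.
  apply: (filter_forall (nbhs_filter t)) => K;
  case: (ltP (t - l) (a K)) => [aK|_]; last exact: nearW.
  have /lt_nbhsl : t < l + a K by lra.
  by apply: filterS => s; lra.
have b_near : \forall s \near t, forall K, b K < t + l -> b K - s <= l.
  apply: (filter_forall (nbhs_filter t)) => K;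
  case: (ltP (b K) (t + l)) => [bK|_]; last exact: nearW.
  have /lt_nbhsr : b K - l < t by lra.
  by apply: filterS => s; lra.
apply: filterS2 a_near b_near => s a_near b_near.
apply/tent_max_leP; split=> [|K eK]; first exact: tent_max_ge0.
have := noleft K; have := noright K; rewrite eK /= !negb_and -!ltNge -!leNgt.
move=> /orP[/a_near ?|bK]; first by left.
move=> /orP[aK|/b_near ?]; last by right.
by case: (leP s t) => st; [left|right]; lra.
Qed.

(** * Weighted sums over half-tents *)

(** What Moebius inversion says about the weights [w] of intervals [a K, b K): over
those that start in the lower set [P] and end in the disjoint upper set [Q], they
sum to 1 or 0 according to whether one of them is in [e]. Unlike the poset of
intervals it comes from, this property is visibly invariant under reflection. *)
Definition counts_cuts (R : realType) (T : finType) (e : pred T)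
    (a b : T -> R) (w : T -> int) : Prop :=
  forall P Q : pred R,
    (forall x y, x <= y -> P y -> P x) -> (forall x y, x <= y -> Q x -> Q y) ->
    (forall x y, P x -> Q y -> x < y) ->
  \sum_(K | P (a K) && Q (b K)) w K = [exists K, [&& e K, P (a K) & Q (b K)]]%:Z.

Lemma counts_cuts_opp (R : realType) (T : finType) (e : pred T)
    (a b : T -> R) (w : T -> int) :
  counts_cuts e a b w -> counts_cuts e (fun K => - b K) (fun K => - a K) w.
Proof.
move=> cuts P Q Pdown Qup PQ.
under eq_bigl do rewrite andbC.
rewrite (cuts (fun x => Q (- x)) (fun x => P (- x))).
- by congr (nat_of_bool _)%:Z; apply: eq_existsb => K; rewrite [X in _ && X]andbC.
- by move=> x y xy; apply: Qup; rewrite lerN2.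
- by move=> x y xy; apply: Pdown; rewrite lerN2.
- by move=> x y Qx Py; rewrite -ltrN2; exact: PQ.
Qed.

(** The intervals with left end [v] are those with left end at most [v], without those
with left end below [v]; both families are cuts, beyond [2 * t - v] on the right.
The second cut meets [e] iff [t - v] is below the maximal half-width [l]; the first
one alone does iff [t - v] is equal to [l] and the interval prolongs to the
right. *)
Lemma cut_at_left_end (R : realType) (T : finType) (e : pred T)
    (a b : T -> R) (w : T -> int) (t v : R) :
  counts_cuts e a b w ->
  \sum_(K | [&& a K < t, 2 * t < a K + b K & a K == v]) w K =
  [&& v == t - tent_max e a b t, 0 < tent_max e a b t & extends_right e a b t]%:Z.
Proof.
move=> cuts; have [tv|vt] := leP t v.
  rewrite big_pred0 => [|K]; last first.
    by apply/negP => /and3P[aKt _ /eqP aKv]; move: aKt tv; rewrite aKv; lra.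
  by case: and3P => // -[/eqP vE l0 _]; exfalso; lra.
have cut_lt := cuts (fun x => x < v) (fun x => 2 * t - v < x).
have cut_le := cuts (fun x => x <= v) (fun x => 2 * t - v < x).
rewrite (_ : \sum_(K | _) w K = \sum_(K | (a K <= v) && (2 * t - v < b K)) w K -
            \sum_(K | (a K < v) && (2 * t - v < b K)) w K); last first.
  rewrite [X in X - _](bigID (fun K => a K < v)) /= [X in X + _ - _](eq_bigl
    (fun K => (a K < v) && (2 * t - v < b K))); last first.
    by move=> K; apply/idP/idP; lra.
  rewrite [X in X - _]addrC addrK; apply: eq_bigl => K.
  apply/and3P/andP => [[_ ? /eqP ?]|[/andP[? ?] ?]]; first by split; lra.
  have aKv : a K = v by lra.
  by rewrite aKv; split; lra.
rewrite {}cut_lt ?{}cut_le; try by [move=> *; lra].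
set l := tent_max e a b t.
(* [t - v] is the half-width of the centered interval that starts at [v] *)
have -> : [exists K, [&& e K, a K < v & 2 * t - v < b K]] = (t - v < l).
  apply/existsP/idP => [[K /and3P[eK aK bK]]|].
    rewrite ltNge; apply/negP => /tent_max_leP[_ /(_ K eK)]; lra.
  move=> vl; have l0 : 0 < l by lra.
  have [K eK [aK bK]] := elimT (tent_max_geP _ _ _ _ l0) (lexx l).
  by exists K; rewrite eK; lra.
have [lt_l|le_l] := ltP (t - v) l.
  have -> : [exists K, [&& e K, a K <= v & 2 * t - v < b K]].
    have l0 : 0 < l by lra.
    have [K eK [aK bK]] := elimT (tent_max_geP _ _ _ _ l0) (lexx l).
    by apply/existsP; exists K; rewrite eK; lra.
  by rewrite subrr; case: eqP => // vE; exfalso; lra.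
rewrite subr0; congr (nat_of_bool _)%:Z; apply/existsP/and3P.
  move=> [K /and3P[eK aK bK]].
  have tv : 0 < t - v by lra.
  have lE : l = t - v.
    apply/eqP; rewrite eq_le le_l; apply/(tent_max_geP _ _ _ _ tv).
    by exists K => //; split; lra.
  split; [by apply/eqP; lra|lra|].
  by apply/existsP; exists K; rewrite -/l lE eK; lra.
move=> [/eqP vE l0 /existsP[K]]; rewrite -/l => /and3P[eK aK bK].
by exists K; rewrite eK; lra.
Qed.

(** Grouping by left ends, only the group at [t - tent_max e a b t] contributes. The left ends are
indexed by a finite type [X] so that they can be summed over. *)
Lemma rising_sum (R : realType) (T X : finType) (e : pred T) (iota : X -> R)
    (ia : T -> X) (a b : T -> R) (w : T -> int) (t : R) :
  injective iota -> a =1 iota \o ia -> counts_cuts e a b w ->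
  \sum_(K | (a K < t) && (2 * t < a K + b K)) w K =
  (0 < tent_max e a b t) && extends_right e a b t.
Proof.
move=> iota_inj aE cuts; set l := tent_max e a b t.
rewrite (partition_big ia xpredT) //=.
under eq_bigr => x _.
  under eq_bigl => K do rewrite -(inj_eq iota_inj) -[iota (ia _)]aE -andbA.
  rewrite (cut_at_left_end t (iota x) cuts).
  over.
(* when the indicator is 1, the witness of prolongation starts at [t - l] *)
rewrite -/l; case: (boolP ((0 < l) && _)) => [/andP[l0 ext]|_]; last first.
  by rewrite big1 // => x _; rewrite andbF.
case/existsP: (ext) => K0; rewrite -/l => /and3P[eK0 aK0 bK0].
have aK0E : a K0 = t - l.
  apply/eqP; rewrite eq_le aK0 leNgt; apply/negP => aK0lt.
  have /tent_max_leP[_ /(_ K0 eK0)] := lexx (tent_max e a b t).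
  by rewrite -/l; lra.
rewrite (bigD1 (ia K0)) //= -[iota (ia K0)]aE aK0E eqxx big1 // => x.
by rewrite -(inj_eq iota_inj) -[iota (ia K0)]aE aK0E => /negbTE ->.
Qed.

(** * Ranks of the extended module *)

(** The rank of a structure map as a total function of its end points, so that it
can be computed without carrying the proof that they are comparable. *)
Definition rank_or0 F d (P : porderType d) (M : persmod F P) (x y : P) : nat :=
  if @idP (x <= y)%O is ReflectT h then prank M h else 0%N.

Lemma rank_or0E F d (P : porderType d) (M : persmod F P) (x y : P)
    (h : (x <= y)%O) : prank M h = rank_or0 M x y.
Proof.
rewrite /rank_or0; case: {-}_ / idP => [h'|//].
by rewrite (bool_irrelevance h h').
Qed.

Lemma rank_or0_reindex F d d' (P : porderType d) (Q : porderType d')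
    (M : persmod F P) (f : Q -> option P) fmono fconvex (x y : Q) :
  (x <= y)%O ->
  rank_or0 (@Defs.reindex F d d' P Q M f fmono fconvex) x y =
  if f x is Some i then if f y is Some j then rank_or0 M i j else 0%N else 0%N.
Proof.
move=> xy; rewrite -(rank_or0E _ xy) /prank /=.
move: (fmono _ _ xy); case: (f x) => [i|]; case: (f y) => [j|] //= h;
  by rewrite -?rank_or0E ?limg0 ?dimv0 // lim0g dimv0.
Qed.

Lemma rank_or0_le F d (P : porderType d) (M : persmod F P) (x x' y' y : P) :
  (x <= x')%O -> (x' <= y')%O -> (y' <= y)%O ->
  (rank_or0 M x y <= rank_or0 M x' y')%N.
Proof.
move=> xx x'y' yy; have x'y := le_trans x'y' yy; have xy := le_trans xx x'y.
rewrite -(rank_or0E _ xy) -(rank_or0E _ x'y') /prank.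
rewrite (pmap_comp M xx x'y xy) (pmap_comp M x'y' yy x'y) !limg_comp.
apply: (@leq_trans (\dim (Defs.pmap M x'y' @: limg (Defs.pmap M xx))%VS)).
  by rewrite -[leqRHS](limg_ker_dim (Defs.pmap M yy)) leq_addl.
by apply: dimvS; rewrite limgS ?subvf.
Qed.

(** Stated with [hatM] and the predecessor [p] of the right end in [m+1], as this
is the form in which [barM] sees the rank. *)
Lemma Rank_finE F m (M : persmod F 'I_m.+1) (K : hoitv 'I_m.+2) (p : 'I_m.+2) :
  hi K = p.+1 :> nat -> Rank_fin M K = rank_or0 (hatM M) (lo K) p.
Proof.
move=> hiK; have lt_lo : (lo K < hi K)%N := ho_lt K.
have hi_max := ltn_ord (hi K).
have lift_inord (q : 'I_m.+2) : (q < m.+1)%N -> lift ord_max (inord q) = q.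
  by move=> qm; apply: val_inj; rewrite -[LHS]/(nat_of_ord _) lift_max inordK.
rewrite /hatM rank_or0_reindex; last by rewrite leEord; lia.
rewrite -[X in unlift _ X]lift_inord ?liftK; last by lia.
rewrite -[X in unlift _ X](@lift_inord p) ?liftK; last by lia.
by rewrite /Rank_fin rank_or0E hiK.
Qed.

Lemma rank_hat_max F m (M : persmod F 'I_m.+1) (x : 'I_m.+2) :
  rank_or0 (hatM M) x ord_max = 0%N.
Proof. by rewrite /hatM rank_or0_reindex ?leEord ?leq_ord // unlift_none; case: unlift. Qed.

Lemma Rank_fin_le_sub F m (M : persmod F 'I_m.+1) (K K' : hoitv 'I_m.+2) :
  (K <= K')%O -> (Rank_fin M K' <= Rank_fin M K)%N.
Proof.
rewrite [(_ <= _)%O]ho_leE !leEord => /andP[lolo hihi].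
have K1 : (lo K < hi K)%N := ho_lt K.
have K2 : (lo K' < hi K')%N := ho_lt K'.
have [h1 h2] := (ltn_ord (hi K), ltn_ord (hi K')).
by rewrite /Rank_fin !rank_or0E; apply: rank_or0_le;
  rewrite leEord /= !inordK; lia.
Qed.


Lemma bar_idx_None (R : realType) m (iota : 'I_m.+2 -> R) (r : R) :
  bar_idx iota r = None -> r < iota ord0.
Proof. by rewrite /bar_idx; case: ltP. Qed.

Lemma bar_idx_Some (R : realType) m (iota : 'I_m.+2 -> R) (r : R) (i : 'I_m.+2) :
    {homo iota : x y / (x <= y)%O >-> x <= y} ->
  bar_idx iota r = Some i <-> forall j, (iota j <= r) = (j <= i)%O.
Proof.
move=> iota_mono; rewrite /bar_idx; case: ltP => [r0|r0]; split=> //.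
- by move=> /(_ ord0); rewrite leEord leq0n leNgt r0.
- case: arg_maxP => //= p pr pmax [<-] j; apply/idP/idP => [/pmax//|jp].
  exact: le_trans (iota_mono _ _ jp) pr.
case: arg_maxP => //= p pr pmax E; congr Some; apply/le_anti.
by rewrite -E pr pmax // E.
Qed.

Lemma Rank_real_geP (R : realType) F (M : persmod F R) (k : nat) (I : hoitv R) :
  (k <= Rank_real M I)%N <->
  forall c, lo I <= c -> c < hi I -> (k <= rank_or0 M (lo I) c)%N.
Proof.
rewrite /Rank_real; case: ex_minnP => n /asboolP[c0 [h0 [c0I <-]]] nmin.
split=> [kn c ac cb|H]; last by rewrite rank_or0E; exact: H.
rewrite -(rank_or0E _ ac); apply: leq_trans kn (nmin _ _).
by apply/asboolP; exists c, ac.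
Qed.

(** Given that all ranks on [I] are at least [k], take for [K] the interval from the
index of the left end of [I] to the first [y] with [hi I <= iota y]: the rank on [K]
is attained in [I] at [iota (y - 1)] (or at the left end, if that is later). Such a
[y] exists, since [barM] vanishes from [iota ord_max] on. *)
Lemma Rank_real_barP (R : realType) F m (M : persmod F 'I_m.+1)
    (iota : 'I_m.+2 -> R) (k : nat) (I : hoitv R) :
    {homo iota : x y / (x <= y)%O >-> x <= y} -> (0 < k)%N ->
  (k <= Rank_real (barM iota M) I)%N <->
  exists2 K : hoitv 'I_m.+2, (k <= Rank_fin M K)%N &
    iota (lo K) <= lo I /\ hi I <= iota (hi K).
Proof.
move=> iota_mono k0; have loI : lo I < hi I := ho_lt I.
rewrite Rank_real_geP; split=> [H|[K kK [Klo Khi]] c ac cb].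
  have rank_at c : lo I <= c -> c < hi I ->
      exists i j : 'I_m.+2, [/\ bar_idx iota (lo I) = Some i,
        bar_idx iota c = Some j & (k <= rank_or0 (hatM M) i j)%N].
    move=> ac cb; have := H c ac cb.
    rewrite /barM rank_or0_reindex //.
    case: (bar_idx iota (lo I)) => [i|]; last by rewrite leqNgt k0.
    case: (bar_idx iota c) => [j|]; last by rewrite leqNgt k0.
    by move=> ?; exists i, j.
  have [i [_ [idx_lo _ _]]] := rank_at _ (lexx _) loI.
  have iloE := (bar_idx_Some _ _ iota_mono).1 idx_lo.
  have hi_max : hi I <= iota ord_max.
    rewrite leNgt; apply/negP => maxlt.
    have [||i' [j [_ idx_c]]] := rank_at (Num.max (lo I) (iota ord_max)).
    - by rewrite le_max lexx.
    - by rewrite gt_max loI.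
    have jE := (bar_idx_Some _ _ iota_mono).1 idx_c.
    have : (ord_max <= j)%O by rewrite -jE le_max lexx orbT.
    rewrite leEord => jmax.
    have -> : j = ord_max by apply: val_inj; have := ltn_ord j; move: jmax => /=; lia.
    by rewrite rank_hat_max leqNgt k0.
  case: (@arg_minP _ _ _ ord_max (fun q => hi I <= iota q) id hi_max) => y yhi ymin.
  have iy : (i < y)%O.
    rewrite ltNge; apply/negP => yi; have : iota y <= lo I by rewrite iloE.
    by rewrite leNgt (lt_le_trans loI yhi).
  have y1 : (y.-1 < m.+2)%N by have := ltn_ord y; lia.
  pose p := Ordinal y1.
  have ylt : (i < y)%N := iy.
  have p_hi : iota p < hi I.
    rewrite ltNge; apply/negP => /ymin; rewrite leEord /=; lia.
  have [||i' [j [idx_lo' idx_c krank]]] := rank_at (Num.max (lo I) (iota p)).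
  - by rewrite le_max lexx.
  - by rewrite gt_max loI.
  have jE := (bar_idx_Some _ _ iota_mono).1 idx_c.
  have pj : (p <= j)%O by rewrite -jE le_max lexx orbT.
  have jy : ~~ (y <= j)%O.
    by rewrite -jE -ltNge gt_max (lt_le_trans loI) // (lt_le_trans p_hi).
  have jp : j = p.
    by apply: val_inj; move: pj jy; rewrite !leEord /=; lia.
  exists (@HoItv _ 'I_m.+2 (i, y) iy); last by rewrite iloE lexx.
  rewrite (@Rank_finE _ _ _ _ p) /=; last by rewrite prednK //; lia.
  by move: krank; rewrite jp idx_lo in idx_lo' *; case: idx_lo' => <-.
rewrite /barM rank_or0_reindex //.
have homE := fun r i => (bar_idx_Some r i iota_mono).1.
have lo0 r : lo I <= r -> ~ (bar_idx iota r = None).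
  move=> ar /bar_idx_None; rewrite ltNge (le_trans _ (le_trans Klo ar)) //.
  by apply: iota_mono; rewrite leEord.
case Ea: (bar_idx iota (lo I)) => [i|]; last by case: (lo0 _ (lexx _)).
case Ec: (bar_idx iota c) => [j|]; last by case: (lo0 _ ac).
have loi : (lo K <= i)%O by rewrite -(homE _ _ Ea).
have ij : (i <= j)%O.
  by rewrite -(homE _ _ Ec); apply: le_trans ac; rewrite (homE _ _ Ea).
have jhi : (j < hi K)%O.
  by rewrite ltNge -(homE _ _ Ec) -ltNge (lt_le_trans cb).
have jhi' : (j < hi K)%N := jhi.
have y1 : ((hi K).-1 < m.+2)%N by have := ltn_ord (hi K); lia.
apply: leq_trans kK _; rewrite (@Rank_finE _ _ _ _ (Ordinal y1)) /=; last by lia.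
by apply: rank_or0_le; rewrite // leEord /=; lia.
Qed.

(** * The landscape as a maximum of tents *)

Definition persists F m (M : persmod F 'I_m.+1) (k : nat) : pred (hoitv 'I_m.+2) :=
  fun K => (k <= Rank_fin M K)%N.

(** The half-widths [h] of the centered intervals of rank at least [k] are exactly
those with [0 < h <= L], [L] being the maximum of the tents. *)
Lemma landscape_tent_max (R : realType) F m (M : persmod F 'I_m.+1)
    (iota : 'I_m.+2 -> R) (k : nat) :
    {homo iota : x y / (x <= y)%O >-> x <= y} -> (0 < k)%N ->
  landscape (barM iota M) k =
  tent_max (persists M k) (iota \o @lo _ _) (iota \o @hi _ _).
Proof.
move=> iota_mono k0; apply/funext => t; rewrite /landscape; set S := [set h | _].
set L := tent_max _ _ _ t.
have SE h : S h <-> 0 < h <= L.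
  split.
    move=> [h0]; rewrite /Rank_real_k /= /ucut; case: leqP => // /Rank_real_barP.
    move=> /(_ iota_mono k0)[K eK [Klo Khi]] _; rewrite h0.
    by apply/(tent_max_geP _ _ _ _ h0); exists K.
  move=> /andP[h0 hL]; exists h0; rewrite /Rank_real_k /= /ucut ifT //.
  apply/Rank_real_barP => //.
  by have [K eK [Klo Khi]] := elimT (tent_max_geP _ _ _ _ h0) hL; exists K.
have : 0 <= L by exact: tent_max_ge0.
rewrite le_eqVlt => /predU1P[L0|L0].
  rewrite (_ : S = set0) ?sup0 //; apply/seteqP; split=> // h /SE.
  by rewrite -L0; lra.
apply/eqP; rewrite eq_le; apply/andP; split.
  by apply: ge_sup => [|h /SE /andP[]//]; exists L; apply/SE; rewrite L0 lexx.
apply: ub_le_sup; first by exists L => h /SE /andP[].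
by apply/SE; rewrite L0 lexx.
Qed.

(** * The sum of slopes *)

Lemma counts_cuts_PD (R : realType) F m (M : persmod F 'I_m.+1)
    (iota : 'I_m.+2 -> R) (k : nat) :
  {homo iota : x y / (x <= y)%O >-> x <= y} ->
  counts_cuts (persists M k) (iota \o @lo _ _) (iota \o @hi _ _) (PD_fin M k).
Proof.
move=> iota_mono P Q Pdown Qup PQ.
have -> : PD_fin M k = fun K => \sum_(K' : hoitv 'I_m.+2 | (K <= K')%O)
    mobius K K' * (persists M k K')%:Z.
  apply/funext => K; apply: eq_bigr => K' _.
  by rewrite /Rank_fin_k /= /ucut /persists; case: (k <= _)%N.
apply: (@cut_sum _ _ (persists M k) (P \o iota) (Q \o iota)) => /=.
- by move=> K K' /(Rank_fin_le_sub M) KK' /leq_trans; apply.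
- by move=> x y /iota_mono; exact: Pdown.
- by move=> x y /iota_mono; exact: Qup.
- move=> x y Px Qy; rewrite ltNge; apply/negP => /iota_mono.
  by rewrite leNgt PQ.
Qed.

Definition tent_slope (R : realType) (a b t : R) : R :=
  \1_(`]a, ((a + b) / 2)[%classic) t - \1_(`]((a + b) / 2), b[%classic) t.

Lemma tent_slopeE (R : realType) (a b t : R) : a < b ->
  tent_slope a b t = ((a < t) && (2 * t < a + b))%:R - ((t < b) && (a + b < 2 * t))%:R.
Proof.
move=> ab; rewrite /tent_slope !indicE; congr (_%:R - _%:R); congr nat_of_bool;
  by apply/idP/idP; rewrite inE /= in_itv /=; lra.
Qed.

(** Every point of the support of the diagram is the image of exactly one interval of
[m+1], so that the sum over the support becomes one over the finite poset. *)
Lemma rho_sum_fin (R : realType) F m (M : persmod F 'I_m.+1)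
    (iota : 'I_m.+2 -> R) (k n : nat) (J : 'I_n -> hoitv R) (c : 'I_n -> int) t :
    injective iota -> {homo iota : x y / (x <= y)%O >-> x <= y} ->
    (forall i, PD_bar iota M k (J i) <> 0) ->
    (forall K : hoitv R,
     PD_bar iota M k K = \sum_(i < n) c i * (\1_([set J i]) K : int)) ->
  rho J c t = \sum_(K : hoitv 'I_m.+2)
    (PD_fin M k K)%:~R * tent_slope (iota (lo K)) (iota (hi K)) t.
Proof.
move=> iota_inj iota_mono J_supp PD_sum.
have iota_lt x y : (x < y)%O -> iota x < iota y.
  by rewrite !lt_neqAle (inj_eq iota_inj) => /andP[-> /iota_mono].
pose push (K : hoitv 'I_m.+2) : hoitv R :=
  @HoItv _ R (iota (lo K), iota (hi K)) (iota_lt _ _ (ho_lt K)).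
have push_inj : injective push.
  move=> K K' /(congr1 val) [/iota_inj lo_eq /iota_inj hi_eq]; apply: val_inj.
  rewrite /= [LHS]surjective_pairing [RHS]surjective_pairing.
  exact: congr2 lo_eq hi_eq.
have PD_push K : PD_bar iota M k (push K) = PD_fin M k K.
  rewrite /PD_bar; case: pickP => [K'|/(_ K)]; last by rewrite !eqxx.
  move=> /andP[/eqP h1 /eqP h2]; congr PD_fin; apply: push_inj.
  by apply: val_inj; rewrite /= h1 h2.
have J_push i : exists K, push K = J i.
  have := J_supp i; rewrite /PD_bar; case: pickP => // K /andP[/eqP h1 /eqP h2] _.
  by exists K; apply: val_inj; rewrite /= h1 h2 -surjective_pairing.
under [RHS]eq_bigr => K _.
  rewrite -PD_push PD_sum rmorph_sum mulr_suml.
  over.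
rewrite exchange_big /=; apply: eq_bigr => i _.
have [K KJ] := J_push i; rewrite (bigD1 K) //= big1 ?addr0 => [|K' K'K].
  by rewrite -KJ [X in c i * X]indicE mem_set // mulr1.
rewrite [X in c i * X]indicE memNset ?mulr0 ?mul0r //= -KJ => /push_inj KE.
by rewrite KE eqxx in K'K.
Qed.

(** The rising halves of the tents are summed by [rising_sum], the falling halves by
its mirror image. *)
Lemma rho_extends (R : realType) F m (M : persmod F 'I_m.+1)
    (iota : 'I_m.+2 -> R) (k n : nat) (J : 'I_n -> hoitv R) (c : 'I_n -> int) t
    (e := persists M k) (a := iota \o @lo _ _) (b := iota \o @hi _ _) :
    injective iota -> {homo iota : x y / (x <= y)%O >-> x <= y} ->
    (forall i, PD_bar iota M k (J i) <> 0) ->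
    (forall K : hoitv R,
     PD_bar iota M k K = \sum_(i < n) c i * (\1_([set J i]) K : int)) ->
  rho J c t = ((0 < tent_max e a b t) && extends_right e a b t)%:R
            - ((0 < tent_max e a b t) && extends_left e a b t)%:R.
Proof.
move=> iota_inj iota_mono J_supp PD_sum.
have ab K : a K < b K.
  rewrite lt_neqAle (inj_eq iota_inj) iota_mono ?ltW ?(ho_lt K) //.
  by rewrite lt_eqF ?(ho_lt K).
rewrite (rho_sum_fin t iota_inj iota_mono J_supp PD_sum).
have cuts := counts_cuts_PD M k iota_mono.
set up := _ && extends_right _ _ _ _; set down := _ && extends_left _ _ _ _.
have upE : \sum_(K | (a K < t) && (2 * t < a K + b K)) PD_fin M k K = up%:Z.
  exact: (rising_sum t iota_inj (fun K => erefl) cuts).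
have downE :
    \sum_(K | (- b K < - t) && (2 * - t < - b K + - a K)) PD_fin M k K = down%:Z.
  rewrite /down -tent_max_opp.
  exact: (rising_sum (- t) (inj_comp oppr_inj iota_inj) (fun K => erefl)
    (counts_cuts_opp cuts)).
rewrite -[up%:R]/(up%:Z%:~R) -[down%:R]/(down%:Z%:~R) -upE -downE.
rewrite 2!rmorph_sum /= [X in _ = X - _]big_mkcond [X in _ = _ - X]big_mkcond /=.
rewrite -sumrB; apply: eq_bigr => K _; rewrite tent_slopeE ?ab //.
have -> : (- b K < - t) && (2 * - t < - b K + - a K) =
    (t < b K) && (a K + b K < 2 * t) by apply/idP/idP; lra.
by case: ifP => _; case: ifP => _; rewrite /= ?mulrBr ?mulr1 ?mulr0.
Qed.

Unset Implicit Arguments.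

Theorem theorem5p6 (R : realType) (F : fieldType) (m : nat)
  (M : persmod F 'I_m.+1)
  (iota : 'I_m.+2 -> R) (iota_inj : injective iota)
  (iota_mono : {homo iota : x y / (x <= y)%O >-> x <= y})
  (k : nat) (k_ge1 : (1 <= k)%N)
  (n : nat) (J : 'I_n -> hoitv R) (c : 'I_n -> int)
  (J_inj : injective J)
  (J_support : forall K : hoitv R,
     PD_bar iota M k K <> 0 <-> exists i, J i = K)
  (c_sign : forall i, c i = -1 \/ c i = 1)
  (PD_sum : forall K : hoitv R,
     PD_bar iota M k K = \sum_(i < n) c i * (\1_([set J i]) K : int)) :
  let lambda : R -> R := landscape (barM iota M) k in
  forall t : R,
    (derivable lambda t 1 -> rho J c t = (lambda^`())%classic t) /\
    (~ derivable lambda t 1 -> rho J c t = 0).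
Proof.
move=> lambda t; rewrite /lambda landscape_tent_max //.
have J_supp i : PD_bar iota M k (J i) <> 0 by apply/J_support; exists i.
rewrite (rho_extends t iota_inj iota_mono J_supp PD_sum).
set e := persists M k; set a := iota \o _; set b := iota \o _.
set l := tent_max e a b.
(* at a critical point, both parts of the claim reduce to rho = 0 *)
have critical (crit : derivable l t 1 -> (l^`())%classic t = 0) :
  (derivable l t 1 -> 0 = (l^`())%classic t) /\ (~ derivable l t 1 -> 0 = 0 :> R).
  by split=> // /crit ->.
have slope (f : R -> R) (d : R) : (\forall s \near t, l s = f s) ->
    is_derive t 1 f d ->
  (derivable l t 1 -> d = (l^`())%classic t) /\ (~ derivable l t 1 -> d = 0).
  move=> lf fd; have [ld ld'] : is_derive t 1 l d.
    by apply: near_eq_is_derive fd; move: lf; apply: filterS => s ->.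
  by split=> //; rewrite derive1E ld'.
have := tent_max_ge0 e a b t; rewrite -/(l t) le_eqVlt => /predU1P[l0|l0].
  rewrite -l0 ltxx subrr; apply: critical => /local_min_derive; apply.
  by apply/(@nearW _ (nbhs t)) => s; rewrite -l0; exact: tent_max_ge0.
rewrite l0 /=.
case: (boolP (extends_right _ _ _ _)) => right;
  case: (boolP (extends_left _ _ _ _)) => left.
- rewrite subrr; apply: critical => /local_min_derive; apply.
  exact: tent_max_valley.
- rewrite subr0; apply: slope (tent_max_up l0 right left) _.
  by apply: is_derive_eq; rewrite subr0.
- rewrite sub0r; apply: slope (tent_max_down l0 right left) _.
  by apply: is_derive_eq; rewrite add0r mul1r.
- rewrite subrr; apply: critical => /local_max_derive; apply.
  exact: tent_max_peak.
Qed.
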